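(* A torsion-free group $G$ is algebraically hyperbolic (AH) if and only if \begin{enumerate} \item $G$ is Adian-free, and \item $G$ is weakly algebraically hyperbolic (weakly AH). \end{enumerate}
   Context: A group is locally cyclic if each of its non-trivial finitely generated subgroups is isomorphic to $\mathbb{Z}$ (equivalently, it is isomorphic to a subgroup of $(\mathbb{Q},+)$). A group $G$ is commutative-transitive if for all $g,h,k\in G\smallsetminus\{1\}$, $[g,h]=1$ and $[h,k]=1$ imply $[g,k]=1$. A torsion-free group $G$ is algebraically hyperbolic (AH) if (a) $G$ is commutative-transitive, and (b) $G$ contains no subgroup of the form $H\rtimes\mathbb{Z}$ with $H$ non-trivial locally cyclic. A group $G$ is weakly algebraically hyperbolic (weakly AH) if it contains no subgroup isomorphic to $\mathbb{Z}^2$ and for every non-trivial $x\in G$ and all $m,n\in\mathbb{Z}$, if $x^m$ and $x^n$ are conjugate in $G$ then $|m|=|n|$. An Adian extension is a finitely generated torsion-free group which maps onto an infinite torsion group with cyclic kernel. A group is Adian-free if it contains no Adian extension as a subgroup. *)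

(* Defs.v *)
From HB Require Import structures.
From mathcomp Require Import all_boot all_order all_algebra.
From mathcomp Require Import boolp classical_sets functions cardinality.

Set Implicit Arguments.
Unset Strict Implicit.
Unset Printing Implicit Defensive.

Local Open Scope classical_set_scope.
Local Open Scope group_scope.

(* Integer powers; the notation x ^ y of group_scope is conjugation. *)
Definition expgz (G : groupType) (x : G) (m : int) : G :=
  match m with
  | Posz n => x ^+ n
  | Negz n => x ^- n.+1
  end.

Record subgroup (G : groupType) := Subgroup {
  sgset : set G;
  sgset_closed : group_closed [in sgset]
}.

Record subgroup_elt (G : groupType) (H : subgroup G) := SubgroupElt {
  sgval : G;
  _ : sgval \in sgset H
}.

HB.instance Definition _ (G : groupType) (H : subgroup G) :=
  [isSub for @sgval G H].
HB.instance Definition _ (G : groupType) (H : subgroup G) :=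
  [Choice of subgroup_elt H by <:].
HB.instance Definition _ (G : groupType) (H : subgroup G) :=
  SubChoice_isSubGroup.Build G _ (subgroup_elt H) (sgset_closed H).

(* Lets a predicate on abstract groups be applied to a subgroup. *)
Definition subgroup_group (G : groupType) (H : subgroup G) : groupType :=
  subgroup_elt H.
Coercion subgroup_group : subgroup >-> Group.type.

Definition isomorphic (G H : groupType) : Prop :=
  exists f : UMagmaMorphism.type G H, bijective f.

Definition Zgrp : groupType := Algebra.to_multiplicative int.

Definition Z2grp : groupType := (Zgrp * Zgrp)%type.

Definition nontrivial (G : groupType) : Prop := exists x : G, x <> 1.

Definition torsion_free (G : groupType) : Prop :=
  forall (x : G) (n : nat), (0 < n)%N -> x ^+ n = 1 -> x = 1.

Definition torsion_group (G : groupType) : Prop :=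
  forall x : G, exists2 n : nat, (0 < n)%N & x ^+ n = 1.

Definition generated (G : groupType) (A : set G) : set G :=
  smallest (fun B : set G => group_closed [in B]) A.

Definition finitely_generated (G : groupType) : Prop :=
  exists s : seq G, generated [set` s] = [set: G].

Definition cyclic_group (G : groupType) : Prop :=
  exists x : G, generated [set x] = [set: G].

Definition locally_cyclic (G : groupType) : Prop :=
  forall H : subgroup G,
    finitely_generated H -> nontrivial H -> isomorphic H Zgrp.

Definition commutative_transitive (G : groupType) : Prop :=
  forall g h k : G, g <> 1 -> h <> 1 -> k <> 1 ->
    [~ g, h] = 1 -> [~ h, k] = 1 -> [~ g, k] = 1.

(* K is the internal semidirect product of its normal subgroup H by T. *)
Definition semidirect (G : groupType) (K H T : subgroup G) : Prop :=
  [/\ sgset H `<=` sgset K, sgset T `<=` sgset K,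
      forall h k : G, sgset H h -> sgset K k -> sgset H (h ^ k),
      sgset H `&` sgset T = [set 1]
    & forall k : G, sgset K k ->
        exists h t : G, [/\ sgset H h, sgset T t & k = h * t]].

Definition algebraically_hyperbolic (G : groupType) : Prop :=
  [/\ torsion_free G,
      commutative_transitive G
    & ~ exists K H T : subgroup G,
          [/\ semidirect K H T, nontrivial H, locally_cyclic H
            & isomorphic T Zgrp]].

Definition weakly_algebraically_hyperbolic (G : groupType) : Prop :=
  ~ (exists H : subgroup G, isomorphic H Z2grp) /\
  forall x : G, x <> 1 -> forall m n : int,
    (exists g : G, expgz x m ^ g = expgz x n) -> `|m|%N = `|n|%N.

Lemma kernel_closed (G Q : groupType) (f : UMagmaMorphism.type G Q) :
  group_closed [in [set x : G | f x = 1]].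
Proof.
split; first by rewrite !inE /= gmulf1.
by move=> x y; rewrite !inE /= gmulfF => -> ->; rewrite divg1.
Qed.

Definition kernel (G Q : groupType) (f : UMagmaMorphism.type G Q) :
  subgroup G := Subgroup (kernel_closed f).

Definition adian_extension (G : groupType) : Prop :=
  [/\ finitely_generated G, torsion_free G
    & exists (Q : groupType) (f : UMagmaMorphism.type G Q),
        [/\ range f = [set: Q], infinite_set [set: Q], torsion_group Q
          & cyclic_group (kernel f)]].

Definition adian_free (G : groupType) : Prop :=
  ~ exists H : subgroup G, adian_extension H.

(* Main.v *)
Require Import Defs.
From mathcomp Require Import all_boot.
From HB Require Import structures.
From mathcomp Require Import all_order all_algebra zify ring.
From mathcomp Require Import boolp classical_sets functions cardinality.

Set Implicit Arguments.
Unset Strict Implicit.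
Unset Printing Implicit Defensive.

Import GRing.Theory Num.Theory.
Local Open Scope classical_set_scope.
Local Open Scope group_scope.

(** Two commuting elements x and y of a torsion-free group that satisfy a
    nontrivial relation [x^i y^j = 1] are powers of one element (Bezout,
    [common_root]); if they satisfy none, they span a copy of Z^2
    ([dependent_of_noZ2]). So in a torsion-free group without Z^2, finitely
    generated abelian subgroups are cyclic, and all abelian subgroups are
    locally cyclic. Both implications rest on this dichotomy.

    AH implies weakly AH and Adian-free. A copy of Z^2 is itself a product [Z
    ><| Z], which AH forbids. Suppose g conjugates [x^m] to [x^n] with [|m| <>
    |n|]. By commutative transitivity the centralizer C of x is abelian and is
    also the centralizer of [x^m] and of [x^n]; hence g normalizes C, and C is
    locally cyclic by the dichotomy. No nontrivial power of g lies in C, as g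
    would then commute with x; so [C ><| <g>] contradicts AH ([AH_weaklyAH]).
    In an Adian extension, each nontrivial element has a nontrivial power in
    the cyclic kernel, so commutative transitivity makes the group abelian and
    any two elements dependent; being finitely generated it is cyclic, and a
    cyclic torsion quotient is finite ([CT_not_adian]).

    Conversely, let G be Adian-free and weakly AH. In [H ><| <t>] with H
    locally cyclic, x <> 1 in H and [x^t] are powers [c^p], [c^q] of one
    element, so t conjugates [x^p] to [x^q] and [|p| = |q|]; then t^2 commutes
    with [x^p] and the two span Z^2 ([weaklyAH_no_semidirect]). For
    commutative transitivity ([weaklyAH_CT]), let h <> 1 commute with g and k,
    and let L be the subgroup generated by g, h, k. As there is no Z^2, each
    nontrivial element of L has a nontrivial power in the central subgroup
    <h>, so L / <h> is torsion, and it is finite since L is not an Adian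
    extension. The transfer from L to <h> = Z is a homomorphism; on <h> it
    multiplies by the index of <h>, so its kernel meets <h> trivially, hence
    is trivial, and L is abelian ([transfer_abelian]). *)

(** * Integer powers *)

Section IntegerPowers.
Variable G : groupType.
Implicit Types (x y g : G) (m n : int).

Lemma expgz_succ x m : expgz x (m + 1)%R = expgz x m * x.
Proof.
case: m => [n|[|n]]; first by rewrite -PoszD addn1 /= expgSr.
  by rewrite /= mulVg.
have -> : (Negz n.+1 + 1)%R = Negz n by lia.
by rewrite /= [x ^+ n.+2]expgS invgM mulgVK.
Qed.

(** Z is free on one generator: the induction behind the identities on integer
    powers. *)
Lemma expgz_uniq x (phi : int -> G) :
  phi 0%R = 1 -> (forall m, phi (m + 1)%R = phi m * x) ->
  forall m, phi m = expgz x m.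
Proof.
move=> phi0 phiS; elim/int_rect => [|n IH|n IH]; first exact: phi0.
  by rewrite intS addrC phiS IH expgz_succ.
apply: (@mulIg _ x); rewrite -phiS -expgz_succ.
by rewrite intS opprD addrC addrA subrr add0r.
Qed.

Lemma expgzD x m n : expgz x (m + n)%R = expgz x m * expgz x n.
Proof.
apply: (@mulgI _ (expgz x m)^-1); rewrite mulKg; move: n.
apply: expgz_uniq => [|n]; first by rewrite addr0 mulVg.
by rewrite addrA expgz_succ mulgA.
Qed.

Lemma expgzN x m : expgz x (- m)%R = (expgz x m)^-1.
Proof. by apply: (@mulIg _ (expgz x m)); rewrite -expgzD addNr mulVg. Qed.

Lemma expgzM x m n : expgz x (m * n)%R = expgz (expgz x m) n.
Proof.
move: n; apply: expgz_uniq => [|n]; first by rewrite mulr0.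
by rewrite mulrDr mulr1 expgzD.
Qed.

Lemma expg1z m : expgz (1 : G) m = 1.
Proof. by rewrite -(@expgz_uniq 1 (fun=> 1)) // => k; rewrite mulg1. Qed.

Lemma conjXzg x g m : expgz x m ^ g = expgz (x ^ g) m.
Proof.
move: m; apply: expgz_uniq => [|m]; first by rewrite conj1g.
by rewrite expgz_succ conjMg.
Qed.

Lemma commuteXz x y m : commute x y -> commute x (expgz y m).
Proof.
by move=> xy; case: m => n; [|apply: commuteV]; exact: commuteX.
Qed.

Lemma commuteXz2 x y m n : commute x y -> commute (expgz x m) (expgz y n).
Proof.
by move=> xy; apply: commuteXz; apply: commute_sym; apply: commuteXz;
  apply: commute_sym.
Qed.

Lemma expgzMn x y m : commute x y -> expgz (x * y) m = expgz x m * expgz y m.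
Proof.
move=> xy; move: m; symmetry; move: m.
apply: expgz_uniq => [|m]; first by rewrite mulg1.
rewrite !expgz_succ -!mulgA; congr (_ * _); rewrite !mulgA; congr (_ * _).
exact: commuteXz.
Qed.

End IntegerPowers.

Lemma gmulfXz (G K : groupType) (f : UMagmaMorphism.type G K) x m :
  f (expgz x m) = expgz (f x) m.
Proof.
move: m; apply: expgz_uniq => [|m]; first by rewrite gmulf1.
by rewrite expgz_succ gmulfM.
Qed.

Lemma torsion_free_expgz (G : groupType) (x : G) (m : int) :
  torsion_free G -> expgz x m = 1 -> m <> 0%R -> x = 1.
Proof.
move=> tfG; case: m => [[|n]|n] //= xm _; apply: (tfG _ n.+1) => //.
by apply: invg_inj; rewrite invg1.
Qed.

Lemma expgz_Zgrp (m : int) : expgz (1%R : Zgrp) m = m.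
Proof. by rewrite -(@expgz_uniq Zgrp 1%R id). Qed.

Lemma expgz_pair (G K : groupType) (x : G) (y : K) m :
  expgz ((x, y) : (G * K)%type) m = (expgz x m, expgz y m).
Proof.
symmetry; move: m; apply: expgz_uniq => // m.
by rewrite !expgz_succ.
Qed.

(** * Subgroups *)

Section Subgroups.
Variable G : groupType.
Implicit Types (x y : G) (A : set G) (H : subgroup G).

Lemma group_closed_set A :
  A 1 -> (forall x y, A x -> A y -> A (x / y)) -> group_closed [in A].
Proof. by move=> A1 AF; split=> [|x y]; rewrite !inE //; apply: AF. Qed.

Lemma sg1 H : sgset H 1.
Proof. by have [] := sgset_closed H; rewrite !inE. Qed.

Lemma sgF H x y : sgset H x -> sgset H y -> sgset H (x / y).
Proof. by have [_] := sgset_closed H; move/(_ x y); rewrite !inE. Qed.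

Lemma sgV H x : sgset H x -> sgset H x^-1.
Proof. by rewrite -div1g => /(sgF (sg1 H)). Qed.

Lemma sgM H x y : sgset H x -> sgset H y -> sgset H (x * y).
Proof. by move=> Hx /sgV /(sgF Hx); rewrite invgK. Qed.

Lemma sgXz H x m : sgset H x -> sgset H (expgz x m).
Proof.
move=> Hx; have HX n : sgset H (x ^+ n).
  by elim: n => [|n IH]; [exact: sg1 | rewrite expgS; exact: sgM].
by case: m => n /=; [|apply: sgV]; exact: HX.
Qed.

Lemma sgvalP H (u : H) : sgset H (sgval u).
Proof. by rewrite -inE; exact: valP. Qed.

Lemma sgval_ex H x : sgset H x -> exists u : H, sgval u = x.
Proof. by rewrite -inE => Hx; exists (SubgroupElt Hx). Qed.

Lemma sgval_inj H : injective (@sgval G H).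
Proof. exact: val_inj. Qed.

Definition sgmor H : UMagmaMorphism.type H G := (val : subgroup_elt H -> G).

Lemma sgval1 H : sgval (1 : H) = 1. Proof. exact: (@gmulf1 _ _ (sgmor H)). Qed.
Lemma sgvalM H (u v : H) : sgval (u * v) = sgval u * sgval v.
Proof. exact: (@gmulfM _ _ (sgmor H)). Qed.
Lemma sgvalXz H (u : H) m : sgval (expgz u m) = expgz (sgval u) m.
Proof. exact: (gmulfXz (sgmor H)). Qed.

Lemma torsion_free_sg H : torsion_free G -> torsion_free H.
Proof.
move=> tfG u n n0 un; apply: sgval_inj; rewrite sgval1; apply: (tfG _ n n0).
by rewrite -[LHS](gmulfXn (sgmor H)) un; exact: sgval1.
Qed.

Lemma commute_sg H (u v : H) : commute (sgval u) (sgval v) <-> commute u v.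
Proof.
split=> [uv|uv]; first by apply: sgval_inj; rewrite !sgvalM.
by rewrite /commute -!sgvalM uv.
Qed.
End Subgroups.

(** Builds a bundled morphism inside a proof, where the map comes from a
    choice and so cannot be given a global instance. *)
Lemma umorphism_of (G K : groupType) (f : G -> K) :
  {morph f : x y / x / y} -> exists h : UMagmaMorphism.type G K, h =1 f.
Proof.
move=> fF; pose m : isGroupMorphism G K f := isGroupMorphism.Build G K f fF.
by exists (HB.pack_for (UMagmaMorphism.type G K) f m).
Qed.

Lemma isomorphic_inv (K G : groupType) (f : UMagmaMorphism.type K G) :
  injective f -> (forall x, exists k, f k = x) -> isomorphic G K.
Proof.
move=> finj /choice [g gP].
have gF : {morph g : u v / u / v}.
  by move=> u v; apply: finj; rewrite gmulfF !gP.
have [h hg] := umorphism_of gF; exists h.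
by exists f => [u|k]; [rewrite hg gP | apply: finj; rewrite hg gP].
Qed.

(** * Generated subgroups *)

Section GeneratedSubgroups.
Variable G : groupType.
Implicit Types (x y : G) (A : set G) (H : subgroup G).

Lemma generated_closed A : group_closed [in generated A].
Proof.
apply: group_closed_set => [B [Bc _]|x y Ax Ay B [Bc AB]].
  exact: (sg1 (Subgroup Bc)).
by apply: (@sgF _ (Subgroup Bc)); [exact: Ax|exact: Ay].
Qed.

Definition gen A : subgroup G := Subgroup (generated_closed A).

Lemma sub_gen A : A `<=` sgset (gen A).
Proof. exact: sub_gen_smallest. Qed.

Lemma gen_sub A H : A `<=` sgset H -> generated A `<=` sgset H.
Proof. by apply: smallest_sub; exact: sgset_closed. Qed.

Lemma cyc_closed x : group_closed [in range (expgz x)].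
Proof.
apply: group_closed_set => [|_ _ [m _ <-] [n _ <-]]; first by exists 0%R.
by exists (m - n)%R; rewrite // expgzD expgzN.
Qed.

Definition cyc x : subgroup G := Subgroup (cyc_closed x).

Lemma generated1 x : generated [set x] = range (expgz x).
Proof.
apply/seteqP; split=> [|_ [m _ <-]].
  by apply: (@gen_sub _ (cyc x)) => _ ->; exists 1%R; rewrite //= expg1.
by apply: (@sgXz _ (gen [set x])); apply: sub_gen.
Qed.

(** Elements of G share a property closed under the group operations as soon
    as finitely many of them do; this is how finite generation is used. *)
Lemma fg_sub : finitely_generated G ->
  exists s : seq G,
    forall H, {in s, forall x, sgset H x} -> forall x, sgset H x.
Proof.
move=> [s Gs]; exists s => K sK x; have: [set: G] x by [].
by rewrite -Gs; apply: gen_sub.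
Qed.
End GeneratedSubgroups.

(** * Images of morphisms *)

Section Image.
Variables (K G : groupType) (f : UMagmaMorphism.type K G).

Lemma image_closed (B : subgroup K) : group_closed [in f @` sgset B].
Proof.
apply: group_closed_set => [|_ _ [x Bx <-] [y By <-]].
  by exists 1; [exact: sg1 | exact: gmulf1].
by exists (x / y); [exact: sgF | rewrite gmulfF].
Qed.

Lemma range_closed : group_closed [in range f].
Proof.
apply: group_closed_set => [|_ _ [x _ <-] [y _ <-]].
  by exists 1; last exact: gmulf1.
by exists (x / y); rewrite ?gmulfF.
Qed.

Definition image_sg B : subgroup G := Subgroup (image_closed B).
Definition range_sg : subgroup G := Subgroup range_closed.

(** Subgroups isomorphic to Z or to Z^2 are obtained as ranges of injective
    morphisms. *)
Lemma range_iso : injective f -> isomorphic range_sg K.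
Proof.
move=> finj.
have fk k : f k \in sgset range_sg by rewrite inE; exists k.
have cF : {morph (fun k => SubgroupElt (fk k) : range_sg) : u v / u / v}.
  by move=> u v; apply: sgval_inj; rewrite /= gmulfF.
have [c cE] := umorphism_of cF; apply: (isomorphic_inv (f := c)).
  by move=> u v; rewrite !cE => /(congr1 (@sgval G range_sg)) /finj.
move=> u; have [k _ ku] := sgvalP u; exists k.
by rewrite cE; apply: sgval_inj.
Qed.
End Image.

(** Finite generation is about [gen] as a group in its own right: the
    generators are lifted to it, and the image in G of any subgroup containing
    the lifts contains s, hence is everything. *)
Lemma gen_fg (G : groupType) (s : seq G) : finitely_generated (gen [set` s]).
Proof.
set H := gen _; exists (pmap insub s : seq (subgroup_elt H)).
apply/seteqP; split=> // u _ B [Bc sB].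
pose B' : subgroup H := Subgroup Bc.
have: sgset (image_sg (sgmor H) B') (sgval u).
  apply: (@gen_sub _ [set` s]); last exact: (@sgvalP _ H u).
  move=> x /= xs; have /sgval_ex [v vE] : sgset H x by exact: sub_gen.
  by exists v => //; apply: sB; rewrite /= mem_pmap_sub /= vE.
by case=> v Bv /sgval_inj <-.
Qed.

(** * Dependent elements and cyclic subgroups *)

Definition dependent (G : groupType) (x y : G) : Prop :=
  exists i j : int, ((i != 0%R) || (j != 0%R)) /\ expgz x i * expgz y j = 1.

(** After division by the gcd (there is no torsion) the exponents i and j
    are coprime; with [u i + v j = 1] the root is [c = x^v y^-u], for which
    [c^j = x] and [c^-i = y]. *)
Lemma common_root (G : groupType) (x y : G) :
  torsion_free G -> commute x y -> dependent x y ->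
  exists (c : G) (p q : int), x = expgz c p /\ y = expgz c q.
Proof.
move=> tfG xy [i [j [ij0 xiyj]]].
have [d_neq0 [i' iE] [j' jE]] : [/\ gcdz i j <> 0%R,
    exists i', i = (i' * gcdz i j)%R & exists j', j = (j' * gcdz i j)%R].
  split; first by move/eqP; rewrite gcdz_eq0; move: ij0; case: eqP; case: eqP.
  - by apply/dvdzP/dvdz_gcdl.
  - by apply/dvdzP/dvdz_gcdr.
have [u [v uv]] : exists u v : int, (u * i' + v * j' = 1)%R.
  have [u [v uv]] := Bezoutz i j; exists u, v.
  apply: (mulIf (introN eqP d_neq0)); rewrite mul1r -[RHS]uv mulrDl -!mulrA.
  by rewrite -iE -jE.
have rel : expgz x i' * expgz y j' = 1.
  apply: (@torsion_free_expgz _ _ (gcdz i j)) => //.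
  by rewrite expgzMn -?expgzM -?iE -?jE //; exact: commuteXz2.
have relu w : expgz x (i' * w)%R * expgz y (j' * w)%R = 1.
  by rewrite !expgzM -expgzMn ?rel ?expg1z //; exact: commuteXz2.
have cX m : expgz (expgz x v * expgz y (- u)%R) m =
    expgz x (v * m)%R * expgz y (- u * m)%R.
  by rewrite expgzMn -?expgzM //; exact: commuteXz2.
exists (expgz x v * expgz y (- u)%R), j', (- i')%R; rewrite !cX; split.
  rewrite (_ : v * j' = 1 + i' * (- u))%R; last by rewrite -uv; ring.
  by rewrite expgzD -mulgA (mulrC (- u)%R) relu mulg1 /= expg1.
rewrite (_ : v * - i' = i' * (- v))%R; last by ring.
rewrite (_ : - u * - i' = j' * (- v) + 1)%R; last by rewrite -uv; ring.
by rewrite expgzD mulgA relu mul1g /= expg1.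
Qed.

(** Replace the generators by a common root, one at a time. *)
Lemma fg_dependent_cyclic (G : groupType) :
  torsion_free G -> (forall x y : G, commute x y) ->
  (forall x y : G, dependent x y) -> finitely_generated G ->
  exists c : G, forall x, exists k, x = expgz c k.
Proof.
move=> tfG cG dG /fg_sub [s sG].
have [c sc] : exists c : G, {in s, forall x, exists k, x = expgz c k}.
  elim: s {sG} => [|x s [c sc]]; first by exists 1.
  have [e [p [q [xp cq]]]] := common_root tfG (cG x c) (dG x c).
  exists e => y; rewrite inE => /orP [/eqP ->|/sc [k ->]]; first by exists p.
  by exists (q * k)%R; rewrite expgzM -cq.
exists c => x; have [|k _ <-] := sG (cyc c) _ x; last by exists k.
by move=> y /sc [k ->]; exists k.
Qed.

Lemma expgz_morphism (G : groupType) (x : G) :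
  exists h : UMagmaMorphism.type Zgrp G, forall m, h m = expgz x m.
Proof.
have xF : {morph (fun m : Zgrp => expgz x m) : m n / m / n}.
  by move=> m n; rewrite -expgzN -expgzD.
by have [h hE] := umorphism_of xF; exists h.
Qed.

Lemma expgz_inj (G : groupType) (x : G) :
  (forall k, expgz x k = 1 -> k = 0%R) -> injective (expgz x).
Proof.
move=> x0 m n xmn; apply/eqP; rewrite -subr_eq0; apply/eqP/x0.
by rewrite expgzD expgzN xmn mulgV.
Qed.

Lemma cyclic_isoZ (G : groupType) (c : G) :
  torsion_free G -> nontrivial G -> (forall x, exists k, x = expgz c k) ->
  isomorphic G Zgrp.
Proof.
move=> tfG [y y1] cG; have [h hE] := expgz_morphism c.
apply: (isomorphic_inv (f := h)) => [m n|x]; last first.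
  by have [k ->] := cG x; exists k.
rewrite !hE; apply: expgz_inj => k ck; apply: contrapT => /torsion_free_expgz.
by move=> /(_ _ c tfG ck) c1; have [k' yE] := cG y; rewrite yE c1 expg1z in y1.
Qed.

Lemma isoZ_generator (G : groupType) : isomorphic G Zgrp ->
  exists t : G, (forall x, exists k, x = expgz t k) /\
                (forall k, expgz t k = 1 -> k = 0%R).
Proof.
move=> [f [g fK gK]]; exists (g (1%R : int)).
have ft k : f (expgz (g (1%R : int)) k) = k.
  by rewrite gmulfXz gK expgz_Zgrp.
split=> [x|k tk]; first by exists (f x); apply: (can_inj fK); rewrite ft.
by rewrite -[k]ft tk gmulf1.
Qed.

(** The hypotheses pass to subgroups, so each finitely generated subgroup is
    cyclic. *)
Lemma locally_cyclic_dependent (G : groupType) :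
  torsion_free G -> (forall x y : G, commute x y) ->
  (forall x y : G, dependent x y) -> locally_cyclic G.
Proof.
move=> tfG cG dG H fgH ntH.
have [||u v|c cH] := @fg_dependent_cyclic H _ _ _ fgH.
- exact: torsion_free_sg.
- by move=> u v; apply/commute_sg.
- have [i [j [ij0 uv]]] := dG (sgval u) (sgval v); exists i, j; split=> //.
  by apply: sgval_inj; rewrite sgvalM !sgvalXz sgval1.
- exact: (cyclic_isoZ (torsion_free_sg tfG) ntH cH).
Qed.

Lemma dependent_of_noZ2 (G : groupType) (x y : G) :
  ~ (exists H : subgroup G, isomorphic H Z2grp) ->
  commute x y -> dependent x y.
Proof.
move=> noZ2 xy; apply: contrapT => ndep; apply: noZ2.
have pF : {morph (fun p : Z2grp => expgz x p.1 * expgz y p.2) : p q / p / q}.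
  move=> [i j] [k l] /=; rewrite invgM -!expgzN !expgzD -!mulgA; congr (_ * _).
  by rewrite [RHS]mulgA -!expgzD; exact: commuteXz2.
have [h hE] := umorphism_of pF; exists (range_sg h); apply: range_iso.
apply: gmulf_inj => -[i j]; rewrite hE /= => xy1.
apply: contrapT => ij; apply: ndep; exists i, j; split=> //.
by apply/negPn/negP; rewrite negb_or !negbK => /andP [/eqP i0 /eqP j0];
  apply: ij; rewrite i0 j0.
Qed.

(** Converse of the previous lemma: a copy of Z^2 provides an independent
    commuting pair. *)
Lemma Z2_independent (G : groupType) (H : subgroup G) : isomorphic H Z2grp ->
  exists x y : G, commute x y /\
    forall i j, expgz x i * expgz y j = 1 -> i = 0%R /\ j = 0%R.
Proof.
move=> [f [g fK gK]].
pose a := g ((1%R : Zgrp, 0%R : Zgrp) : Z2grp).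
pose b := g ((0%R : Zgrp, 1%R : Zgrp) : Z2grp).
have fab i j : f (expgz a i * expgz b j) = (i, j).
  rewrite gmulfM !gmulfXz !gK !expgz_pair !expgz_Zgrp.
  rewrite !(@expg1z Zgrp).
  by rewrite /mul /=; congr (_, _); [exact: addr0|exact: add0r].
exists (sgval a), (sgval b); split.
  apply/commute_sg; apply: (can_inj fK); rewrite !gmulfM !gK.
  by rewrite /mul /=; congr (_, _); exact: addrC.
move=> i j; rewrite -!sgvalXz -sgvalM -(sgval1 H) => /sgval_inj ab1.
have := fab i j; rewrite ab1 gmulf1 => -[<- <-] //.
Qed.

(** The product [H <g>] is the set of all [h g^k]. Both conjugations are
    required, as g could map H onto a proper subgroup of itself. *)
Lemma semidirect_of (G : groupType) (H : subgroup G) (g : G) :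
  (forall h, sgset H h -> sgset H (h ^ g)) ->
  (forall h, sgset H h -> sgset H (h ^ g^-1)) ->
  (forall k, sgset H (expgz g k) -> k = 0%R) ->
  exists K T : subgroup G, semidirect K H T /\ isomorphic T Zgrp.
Proof.
move=> Hg HVg Hg0.
have HJ k h : sgset H h -> sgset H (h ^ expgz g k).
  elim/int_rect: k h => [|n IH|n IH] h Hh; first by rewrite conjg1.
    by rewrite intS addrC expgz_succ conjgM; apply/Hg/IH.
  by rewrite intS opprD addrC expgzD conjgM; apply/HVg/IH.
have Kc : group_closed
    [in [set z | exists h k, sgset H h /\ z = h * expgz g k]].
  apply: group_closed_set => [|_ _ [h [k [Hh ->]]] [h' [k' [Hh' ->]]]].
    by exists 1, 0%R; split; [exact: sg1|rewrite mulg1].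
  exists (h * (h'^-1 ^ expgz g (k' - k)%R)), (k - k')%R; split.
    by apply: sgM => //; apply/HJ/sgV.
  rewrite invgM -mulgA -mulgA; congr (_ * _); rewrite mulgA -expgzN -expgzD.
  by rewrite conjgCV -expgzN opprB.
have [phi phiE] := expgz_morphism g.
exists (Subgroup Kc), (range_sg phi); split; last first.
  apply: range_iso => m n; rewrite !phiE; apply: expgz_inj => k gk.
  by apply: Hg0; rewrite gk; apply: sg1.
split=> [h Hh|_ [k _ <-]|h z Hh [h' [k [Hh' ->]]]||_ [h [k [Hh ->]]]] /=.
- by exists h, 0%R; split; rewrite ?mulg1.
- by exists 1, k; split; [exact: sg1|rewrite phiE mul1g].
- by rewrite conjgM; apply/HJ/sgM; [apply: sgV|apply: sgM].
- apply/seteqP; split=> [z [Hz [k _ zE]]|_ ->].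
    by move: Hz; rewrite /= -zE phiE => /Hg0 ->.
  by split; [exact: sg1|exact: (sg1 (range_sg phi))].
- by exists h, (expgz g k); split=> //; exists k.
Qed.

(** * Algebraically hyperbolic groups are weakly so *)

(** Since 1 commutes with everything, transitivity can only fail through a
    trivial middle element. *)
Lemma commute_trans (G : groupType) (h g k : G) :
  commutative_transitive G -> h <> 1 ->
  commute g h -> commute h k -> commute g k.
Proof.
move=> ctG h1 gh hk.
have [->|/eqP g1] := eqVneq g 1; first exact/commute_sym/commute1.
have [->|/eqP k1] := eqVneq k 1; first exact: commute1.
by apply/commgP/eqP; apply: (ctG g h k) => //; apply/eqP/commgP.
Qed.

Lemma cyc_locally_cyclic (G : groupType) (x : G) :
  torsion_free G -> locally_cyclic (cyc x).
Proof.
move=> tfG.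
have cycE (u : cyc x) : exists k, sgval u = expgz x k.
  by have [k _ <-] := sgvalP u; exists k.
apply: locally_cyclic_dependent; first exact: torsion_free_sg.
  move=> u v; apply/commute_sg; have [k ->] := cycE u; have [l ->] := cycE v.
  exact: commuteXz2.
move=> u v; have [k uE] := cycE u; have [l vE] := cycE v.
have [k0|k0] := eqVneq k 0%R.
  exists 1%R, 0%R; split=> //; apply: sgval_inj.
  by rewrite sgval1 sgvalM !sgvalXz uE k0 mulg1 /= expg1.
exists l, (- k)%R; split; first by rewrite oppr_eq0 k0 orbT.
apply: sgval_inj; rewrite sgval1 sgvalM !sgvalXz uE vE -!expgzM -expgzD.
by rewrite mulrN [(k * l)%R]mulrC subrr.
Qed.

(** In Z^2, either factor is locally cyclic and the other one, acting
    trivially, is a complement isomorphic to Z. *)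
Lemma AH_noZ2 (G : groupType) : algebraically_hyperbolic G ->
  ~ (exists H : subgroup G, isomorphic H Z2grp).
Proof.
move=> [tfG _ noSD] [_ /Z2_independent [x [y [xy indep]]]]; apply: noSD.
have conjx z : commute x z ->
    forall h, sgset (cyc x) h -> sgset (cyc x) (h ^ z).
  move=> xz _ [k _ <-]; exists k => //; symmetry; apply/conjg_fixP/commgP.
  exact/commute_sym/commuteXz/commute_sym.
have [|||K [T [sdK TZ]]] := @semidirect_of G (cyc x) y.
- exact: conjx.
- exact/conjx/commuteV.
- move=> k [l _ xl]; have [|_ k0] := indep l (- k)%R; last by lia.
  by rewrite expgzN xl mulgV.
exists K, (cyc x), T; split=> //; last exact: cyc_locally_cyclic.
have /sgval_ex [u uE] : sgset (cyc x) x by exists 1%R.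
exists u => u1; have [|//] := indep 1%R 0%R.
by rewrite mulg1 /= expg1 -uE u1 sgval1.
Qed.

Lemma centralizer_closed (G : groupType) (x : G) :
  group_closed [in [set y | commute y x]].
Proof.
apply: group_closed_set => [|y z /= yx zx]; first exact/commute_sym/commute1.
by apply/commute_sym/commuteM; [|apply/commuteV]; apply/commute_sym.
Qed.

Definition centralizer (G : groupType) (x : G) : subgroup G :=
  Subgroup (@centralizer_closed G x).

(** The forbidden subgroup is [C ><| <g>], for C the centralizer of x and g
    conjugating [x^m] to [x^n]. *)
Lemma AH_weaklyAH (G : groupType) : algebraically_hyperbolic G ->
  weakly_algebraically_hyperbolic G.
Proof.
move=> AH; have noZ2 := AH_noZ2 AH; split=> // x x1 m n [g xmn].
have [tfG ctG noSD] := AH; apply: contrapT => mn; apply: noSD.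
have x0 k : expgz x k = 1 -> k = 0%R.
  by move=> xk; apply: contrapT => /(torsion_free_expgz tfG xk).
have xinj := expgz_inj x0.
have [m0 n0] : m <> 0%R /\ n <> 0%R.
  split=> k0; apply: mn; first by rewrite k0 (x0 n) // -xmn k0 conj1g.
  by rewrite k0 (x0 m) //; apply: (@conjg_inj _ g); rewrite conj1g xmn k0.
have xnm : expgz x n ^ g^-1 = expgz x m by rewrite -xmn conjgK.
(* If h commutes with x, then h^z commutes with x^l, and so with x. *)
have conjC z k l : l <> 0%R -> expgz x k ^ z = expgz x l ->
    forall h, sgset (centralizer x) h -> sgset (centralizer x) (h ^ z).
  move=> l0 xkl h /= hx; have xl1 : expgz x l <> 1 by move/x0.
  apply: (commute_trans ctG xl1); last exact/commute_sym/commuteXz.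
  rewrite -xkl /commute -!conjMg; congr (_ ^ _).
  exact: commuteXz.
(* If g commutes with x, then the conjugation fixes x^m, so m = n. *)
have ngx : ~ commute g x.
  move=> gx; apply: mn; congr absz; apply: xinj; rewrite -xmn; symmetry.
  by apply/conjg_fixP/commgP/commute_sym/commuteXz.
have [|||K [T [sdK TZ]]] := @semidirect_of G (centralizer x) g.
- exact: conjC xmn.
- exact: conjC xnm.
- move=> k /= gkx; apply: contrapT => k0; apply: ngx.
  have gk1 : expgz g k <> 1.
    move=> /(torsion_free_expgz tfG) /(_ k0) g1; apply: mn; congr absz.
    by apply: xinj; rewrite -xmn g1 conjg1.
  exact: (commute_trans ctG gk1 (commuteXz k (commute_refl g)) gkx).
have cC (u v : centralizer x) : commute u v.
  apply/commute_sg/(commute_trans ctG x1); first exact: (sgvalP u).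
  exact/commute_sym/(sgvalP v).
exists K, (centralizer x), T; split=> //.
  have /sgval_ex [u uE] : sgset (centralizer x) x by [].
  by exists u => u1; apply: x1; rewrite -uE u1 sgval1.
apply: locally_cyclic_dependent => //; first exact: torsion_free_sg.
move=> u v; have uv := (commute_sg u v).2 (cC u v).
have [i [j [ij uv1]]] := dependent_of_noZ2 noZ2 uv.
by exists i, j; split=> //; apply: sgval_inj; rewrite sgval1 sgvalM !sgvalXz.
Qed.

(** * Adian extensions *)

Lemma kernel_generator (G Q : groupType) (f : UMagmaMorphism.type G Q) :
  cyclic_group (kernel f) <->
  exists z : G, forall x, f x = 1 <-> exists k, x = expgz z k.
Proof.
split=> [[z zgen]|[z kz]].
  exists (sgval z) => x; split=> [fx1|[k ->]]; last first.
    have fz1 : f (sgval z) = 1 by exact: (sgvalP z).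
    by rewrite gmulfXz fz1 expg1z.
  have [u <-] : exists u : kernel f, sgval u = x by exact: sgval_ex.
  have: [set: kernel f] u by [].
  by rewrite -zgen generated1 => -[k _ <-]; exists k; rewrite sgvalXz.
have /sgval_ex [w wE] : sgset (kernel f) z.
  by apply/kz; exists 1%R; rewrite /= expg1.
exists w; rewrite generated1; apply/seteqP; split=> // u _.
have /kz [k uk] := sgvalP u; exists k => //.
by apply: sgval_inj; rewrite sgvalXz wE uk.
Qed.

(** Commutative transitivity through the kernel makes the group abelian with
    any two elements dependent, hence cyclic; then the torsion quotient is
    finite. *)
Lemma CT_not_adian (G : groupType) :
  commutative_transitive G -> ~ adian_extension G.
Proof.
move=> ctG [fgG tfG [Q [f [fsurj Qinf Qtor /kernel_generator [z kz]]]]].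
have pow x : exists n k : int, n <> 0%R /\ expgz x n = expgz z k.
  have [n n0 fxn] := Qtor (f x).
  have /kz [k xk] : f (x ^+ n) = 1 by rewrite gmulfXn.
  by exists (Posz n), k; split=> //; case; lia.
have cz x : commute x z.
  have [->|/eqP x1] := eqVneq x 1; first exact/commute_sym/commute1.
  have [n [k [n0 xn]]] := pow x.
  have xn1 : expgz x n <> 1 by move=> /(torsion_free_expgz tfG) /(_ n0).
  apply: (commute_trans ctG xn1); first exact: commuteXz.
  by rewrite xn; apply/commute_sym/commuteXz.
have cG (x y : G) : commute x y.
  have [z1|/eqP z1] := eqVneq z 1; last first.
    exact: commute_trans ctG z1 (cz x) (esym (cz y)).
  have [n [k [n0 xn]]] := pow x.
  have -> : x = 1 by apply: (torsion_free_expgz tfG _ n0); rewrite xn z1 expg1z.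
  exact/commute_sym/commute1.
have dG (x y : G) : dependent x y.
  have [n [k [/eqP n0 xn]]] := pow x; have [m [l [/eqP m0 ym]]] := pow y.
  have [k0|k0] := eqVneq k 0%R.
    by exists n, 0%R; rewrite n0 xn k0 mulg1.
  exists (n * l)%R, (m * - k)%R; split.
    by apply/orP; right; rewrite mulf_neq0 ?oppr_eq0.
  by rewrite !expgzM xn ym -!expgzM -expgzD mulrN [(k * l)%R]mulrC subrr.
have [c cycG] := fg_dependent_cyclic tfG cG dG fgG.
have [N N0 fcN] := Qtor (f c).
pose powers : set Q := (fun i => f c ^+ i) @` `I_N.
apply: Qinf; apply: (@sub_finite_set _ _ powers); last first.
  exact/finite_image/finite_II.
move=> q _; have: [set: Q] q by []; rewrite -fsurj => -[x _ <-].
have [k ->] := cycG x; rewrite gmulfXz.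
exists `|(k %% N)%Z|%N; first by rewrite /=; lia.
rewrite [in RHS](divz_eq k N) expgzD mulrC expgzM /= fcN expg1z mul1g.
by rewrite -[in RHS](gez0_abs (modz_ge0 k _)) //; lia.
Qed.

Lemma AH_adian_free (G : groupType) :
  algebraically_hyperbolic G -> adian_free G.
Proof.
move=> [tfG ctG _] [H adH]; apply: (CT_not_adian _ adH) => g h k g1 h1 k1 gh hk.
have val1 (u : H) : u <> 1 -> sgval u <> 1.
  by move=> u1 vu; apply/u1/sgval_inj; rewrite sgval1.
apply/eqP/commgP/commute_sg/(commute_trans ctG (val1 h h1)).
  by apply/commute_sg/commgP/eqP.
by apply/commute_sg/commgP/eqP.
Qed.

(** * Quotients by normal subgroups *)

Section Quotient.
Variables (G : groupType) (N : subgroup G).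
Hypothesis nN : forall g h, sgset N h -> sgset N (h ^ g).

Definition coset_rel (x y : G) : bool := `[< sgset N (x / y) >].

Lemma coset_rel_equiv : equiv_class_of coset_rel.
Proof.
split=> [x|x y|y x z]; first by apply/asboolP; rewrite mulgV; exact: sg1.
  by apply/asboolP/asboolP => /sgV; rewrite invgF.
move=> /asboolP xy /asboolP yz; apply/asboolP.
by rewrite -(divgKA y); exact: sgM.
Qed.

Definition coset_equiv := EquivRelPack coset_rel_equiv.

(** The proof of normality is an argument of the type, so that the group
    structure, which depends on it, can be attached to the type. *)
Definition quotient_type of (forall g h, sgset N h -> sgset N (h ^ g)) :=
  {eq_quot coset_equiv}%qT.
Local Notation Q := (quotient_type nN).
HB.instance Definition _ := Choice.on Q.

Definition quot_pi (x : G) : Q := \pi_({eq_quot coset_equiv})%qT x.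
Definition quot_repr (q : Q) : G := repr (q : {eq_quot coset_equiv}%qT).

Lemma quot_reprK : cancel quot_repr quot_pi.
Proof. by move=> q; exact: reprK. Qed.

Lemma quot_piP x y : quot_pi x = quot_pi y <-> sgset N (x / y).
Proof.
by split=> [/eqmodP|xy]; [move=> /asboolP | apply/eqmodP/asboolP].
Qed.

Let one : Q := quot_pi 1.
Let mul (p q : Q) : Q := quot_pi (quot_repr p * quot_repr q).
Let inv (q : Q) : Q := quot_pi (quot_repr q)^-1.

Lemma quot_reprP x : exists2 n, sgset N n & quot_repr (quot_pi x) = n * x.
Proof.
exists (quot_repr (quot_pi x) / x); last by rewrite mulgVK.
by apply/quot_piP; exact: quot_reprK.
Qed.

Lemma quot_piM x y : mul (quot_pi x) (quot_pi y) = quot_pi (x * y).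
Proof.
have [n Nn nE] := quot_reprP x; have [m Nm mE] := quot_reprP y.
apply/quot_piP; rewrite nE mE.
rewrite (_ : _ / _ = n * (m ^ x^-1)); first by apply: sgM => //; exact: nN.
by rewrite conjgE invgK invgM !mulgA mulgK.
Qed.

Lemma quot_piV x : inv (quot_pi x) = quot_pi x^-1.
Proof.
have [n Nn nE] := quot_reprP x; apply/quot_piP; rewrite nE invgK invgM.
rewrite (_ : _ * x = n^-1 ^ x); first by apply/nN/sgV.
by rewrite conjgE mulgA.
Qed.

Lemma quot_mulA : associative mul.
Proof.
move=> p q r; rewrite -[p]quot_reprK -[q]quot_reprK -[r]quot_reprK.
by rewrite !quot_piM mulgA.
Qed.

Lemma quot_mul1g : left_id one mul.
Proof. by move=> p; rewrite -[p]quot_reprK /one quot_piM mul1g. Qed.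

Lemma quot_mulg1 : right_id one mul.
Proof. by move=> p; rewrite -[p]quot_reprK /one quot_piM mulg1. Qed.

Lemma quot_mulVg : left_inverse one inv mul.
Proof. by move=> p; rewrite -[p]quot_reprK quot_piV quot_piM mulVg. Qed.

Lemma quot_mulgV : right_inverse one inv mul.
Proof. by move=> p; rewrite -[p]quot_reprK quot_piV quot_piM mulgV. Qed.

HB.instance Definition _ := isGroup.Build Q
  quot_mulA quot_mul1g quot_mulg1 quot_mulVg quot_mulgV.

Lemma quotient_exists : exists (K : groupType) (f : UMagmaMorphism.type G K),
  range f = [set: K] /\ forall x, f x = 1 <-> sgset N x.
Proof.
have piF : {morph quot_pi : x y / x / y >-> (x / y : Q)}.
  by move=> x y; rewrite -quot_piM -quot_piV.
have [f fE] := umorphism_of piF; exists (Q : groupType), f; split.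
  apply/seteqP; split=> // q _.
  by exists (quot_repr q); rewrite ?fE ?quot_reprK.
by move=> x; rewrite fE -{2}[x]divg1; exact: quot_piP.
Qed.
End Quotient.

(** The transfer to a central cyclic subgroup <z> of finite index. Choose a
    section t of f and define e by [g * t q = t (f g * q) * z ^ (e g q)]; then
    [e (g g') q = e g (f g' q) + e g' q], so the sum V of e g over the quotient
    is additive in g, the first term being reindexed by the permutation
    [q -> f g' q]. Now [V (z^k)] is k times the index, and each element x <> 1
    has a nontrivial power in <z>; so V has trivial kernel, which forces
    commutativity. *)
Lemma transfer_abelian (G Q : groupType) (f : UMagmaMorphism.type G Q) (z : G) :
  torsion_free G -> range f = [set: Q] -> finite_set [set: Q] ->
  torsion_group Q -> (forall x, f x = 1 <-> exists k, x = expgz z k) ->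
  (forall x, commute x z) -> forall x y : G, commute x y.
Proof.
move=> tfG fsurj Qfin Qtor kz cz.
have pow x : exists (n : nat) (k : int), (0 < n)%N /\ x ^+ n = expgz z k.
  have [n n0 fxn] := Qtor (f x).
  have /kz [k xk] : f (x ^+ n) = 1 by rewrite gmulfXn.
  by exists n, k.
have [z1 x y|/eqP z1] := eqVneq z 1.
  have G1 (u : G) : u = 1.
    have [n [k [n0 un]]] := pow u; apply: (tfG _ _ n0).
    by rewrite un z1 expg1z.
  by rewrite (G1 x) (G1 y).
have zinj : injective (expgz z).
  apply: expgz_inj => k zk; apply: contrapT => k0.
  exact/z1/(torsion_free_expgz tfG zk).
have /choice [t tE] (q : Q) : exists x, f x = q.
  have: [set: Q] q by [].
  by rewrite -fsurj => -[x _ <-]; exists x.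
have /choice [e0 e0E] (p : G * Q) :
    exists k, p.1 * t p.2 = t (f p.1 * p.2) * expgz z k.
  have /kz [k kE] : f ((t (f p.1 * p.2))^-1 * (p.1 * t p.2)) = 1.
    by rewrite !gmulfM gmulfV !tE mulVg.
  by exists k; rewrite -kE mulVKg.
pose e g q := e0 (g, q).
have eE g q : g * t q = t (f g * q) * expgz z (e g q) by exact: (e0E (g, q)).
have eM g g' q : e (g * g') q = (e g (f g' * q)%g + e g' q)%R.
  apply: zinj; apply: (mulgI (t (f (g * g') * q))); rewrite -eE expgzD.
  by rewrite gmulfM -[f g * _ * q]mulgA [RHS]mulgA -eE -[RHS]mulgA -eE mulgA.
have ez k q : e (expgz z k) q = k.
  have fz : f (expgz z k) = 1 by apply/kz; exists k.
  apply: zinj; apply: (mulgI (t q)).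
  have := eE (expgz z k) q; rewrite fz mul1g => <-.
  exact/commute_sym/commuteXz.
have [s s_uniq sQ] : exists2 s : seq Q, uniq s & forall q, q \in s.
  have [s sE] := (finite_seqP _).1 Qfin.
  exists (undup s); first exact: undup_uniq.
  move=> q; rewrite mem_undup.
  by have: [set: Q] q by []; rewrite sE.
pose V g := (\sum_(q <- s) e g q)%R.
have VM g g' : V (g * g') = (V g + V g')%R.
  rewrite /V (eq_bigr _ (fun q _ => eM g g' q)) big_split /=; congr (_ + _)%R.
  rewrite -(big_map (fun q => f g' * q) xpredT (e g)).
  apply: perm_big; apply: uniq_perm => //.
    by rewrite map_inj_uniq //; exact: mulgI.
  move=> q; rewrite sQ; apply/mapP; exists ((f g')^-1 * q) => //.
  by rewrite mulVKg.
have V1 : V 1 = 0%R by apply: (@addrI _ (V 1)); rewrite -VM mulg1 addr0.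
have VX g n : V (g ^+ n) = (V g *+ n)%R.
  by elim: n => [|n IH]; rewrite ?mulr0n // expgS VM IH mulrS.
have Vz k : V (expgz z k) = (k *+ size s)%R.
  rewrite /V (eq_bigr _ (fun q _ => ez k q)) big_const_seq count_predT.
  by rewrite iter_addr_0.
have V_inj g : V g = 0%R -> g = 1.
  move=> Vg; have [n [k [n0 gn]]] := pow g; apply: (tfG _ _ n0).
  have := VX g n; rewrite gn Vz Vg mul0rn => /eqP; rewrite mulrn_eq0.
  by have := sQ 1; case: (s) => //= _ _ _ /eqP ->.
move=> x y; apply/commgP/eqP/V_inj.
by apply: (@addrI _ (V (y * x))); rewrite -VM -commgC !VM addrC addr0.
Qed.

(** * Weakly algebraically hyperbolic groups *)

(** The group L generated by g, h, k has h in its centre, with torsion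
    quotient L / <h>, as any element and h are dependent. If this quotient
    were infinite, L would be an Adian extension. *)
Lemma weaklyAH_CT (G : groupType) :
  torsion_free G -> adian_free G -> weakly_algebraically_hyperbolic G ->
  commutative_transitive G.
Proof.
move=> tfG noAdian [noZ2 _] g h k g1 h1 k1.
move=> /eqP/commgP gh /eqP/commgP hk; apply/eqP/commgP.
pose s := [:: g; h; k]; pose L := gen [set` s].
have tfL : torsion_free L by exact: torsion_free_sg.
have Lin x : x \in s -> exists u : L, sgval u = x.
  by move=> xs; apply: sgval_ex; apply: sub_gen.
have [a aE] : exists u : L, sgval u = g by apply: Lin; rewrite !inE eqxx.
have [z zE] : exists u : L, sgval u = h by apply: Lin; rewrite !inE eqxx orbT.
have [b bE] : exists u : L, sgval u = k by apply: Lin; rewrite !inE eqxx !orbT.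
have cz (u : L) : commute u z.
  apply/commute_sg; rewrite zE.
  have sC : [set` s] `<=` sgset (centralizer h).
    by move=> x /=; rewrite !inE => /or3P [] /eqP ->.
  exact: (gen_sub sC (sgvalP u)).
have nz (v u : L) : sgset (cyc z) u -> sgset (cyc z) (u ^ v).
  move=> [i _ <-]; exists i => //; symmetry; apply/conjg_fixP/commgP.
  exact/commute_sym/commuteXz.
have [Q [f [fsurj kf]]] := quotient_exists nz.
have kz u : f u = 1 <-> exists i, u = expgz z i.
  by rewrite kf; split=> [[i _ <-]|[i ->]]; exists i.
have Qtor : torsion_group Q.
  move=> q; have: [set: Q] q by []; rewrite -fsurj => -[u _ <-].
  have [i [j [ij uz]]] : dependent u z.
    have [i [j [ij uz]]] := dependent_of_noZ2 noZ2 ((commute_sg u z).2 (cz u)).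
    exists i, j; split=> //; apply: sgval_inj.
    by rewrite sgval1 sgvalM !sgvalXz.
  have i0 : i <> 0%R.
    move=> i0; move: ij uz; rewrite i0 eqxx mul1g /= => /eqP j0 zj.
    apply: h1; rewrite -zE (torsion_free_expgz tfL zj j0) sgval1 //.
  have fui : expgz (f u) i = 1.
    rewrite -gmulfXz; apply/kz; exists (- j)%R; rewrite expgzN.
    by apply/eqP; rewrite -mulg_eq1; apply/eqP.
  exists `|i|%N; first by lia.
  case: i i0 fui {ij uz} => [n|n] _ //= fun1.
  by apply: invg_inj; rewrite invg1.
have cL : forall u v : L, commute u v.
  apply: (transfer_abelian tfL fsurj _ Qtor kz cz).
  apply: contrapT => Qinf; apply: noAdian; exists L; split=> //.
    exact: gen_fg.
  by exists Q, f; split=> //; apply/kernel_generator; exists z.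
by rewrite -aE -bE; apply/commute_sg.
Qed.

Lemma locally_cyclic_pair (G : groupType) (x y : G) :
  locally_cyclic G -> x <> 1 ->
  exists (c : G) (p q : int), x = expgz c p /\ y = expgz c q.
Proof.
move=> lcG x1; pose L := gen [set` [:: x; y]].
have Lin z : z \in [:: x; y] -> exists u : L, sgval u = z.
  by move=> zs; apply: sgval_ex; apply: sub_gen.
have [u uE] := Lin x (mem_head _ _).
have [v vE] : exists v : L, sgval v = y by apply: Lin; rewrite !inE eqxx orbT.
have /isoZ_generator [c [cE _]] : isomorphic L Zgrp.
  apply: lcG; [exact: gen_fg | exists u => u1].
  by apply: x1; rewrite -uE u1 sgval1.
have [p up] := cE u; have [q vq] := cE v; exists (sgval c), p, q.
by rewrite -uE -vE -!sgvalXz -up -vq.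
Qed.

(** With [x = c^p] and [x^t = c^q], one has [(x^p)^t = c^(pq) = x^q]. So t acts
    on [x^p] by a sign, t^2 commutes with it, and the pair must be dependent;
    but H and T meet trivially. *)
Lemma weaklyAH_no_semidirect (G : groupType) (K H T : subgroup G) :
  torsion_free G -> weakly_algebraically_hyperbolic G ->
  semidirect K H T -> nontrivial H -> locally_cyclic H ->
  ~ isomorphic T Zgrp.
Proof.
move=> tfG [noZ2 wAH] [_ TK nH HT _] [u u1] lcH /isoZ_generator [w [_ w0]].
pose x := sgval u; pose t := sgval w.
have x1 : x <> 1 by move=> xE; apply/u1/sgval_inj; rewrite sgval1.
have xk k : expgz x k = 1 -> k = 0%R.
  by move=> xk1; apply: contrapT => /(torsion_free_expgz tfG xk1).
have t0 k : expgz t k = 1 -> k = 0%R.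
  by move=> tk; apply: w0; apply: sgval_inj; rewrite sgval1 sgvalXz.
have [v vE] : exists v : H, sgval v = x ^ t.
  by apply/sgval_ex/nH; [exact: sgvalP|apply/TK/sgvalP].
have [c [p [q [up vq]]]] := locally_cyclic_pair v lcH u1.
have p0 : p <> 0%R by move=> p0; apply: u1; rewrite up p0.
have xpt : expgz x p ^ t = expgz x q.
  rewrite conjXzg -vE -!sgvalXz; congr sgval.
  by rewrite vq up -!expgzM mulrC.
have xptt : expgz x p ^ (t * t) = expgz x p.
  have pq := wAH x x1 p q (ex_intro _ t xpt); rewrite conjgM xpt.
  have [qE|qE] : q = p \/ q = (- p)%R by lia.
    by rewrite qE xpt qE.
  by rewrite qE expgzN conjVg xpt qE expgzN invgK.
have xptc : commute (expgz x p) (t * t).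
  by apply/commgP/conjg_fixP.
have [i [j [ij rel]]] := dependent_of_noZ2 noZ2 xptc.
have Ht : sgset H (expgz (t * t) j).
  have -> : expgz (t * t) j = (expgz (expgz x p) i)^-1.
    by rewrite (mulg1_eq rel).
  by apply/sgV/sgXz/sgXz/sgvalP.
have tt1 : expgz (t * t) j = 1.
  suff: [set 1] (expgz (t * t) j) by [].
  by rewrite -HT; split=> //; apply/sgXz/sgM; exact: sgvalP.
have j0 : j = 0%R.
  have /t0 : expgz t (2 * j)%R = 1 by rewrite expgzM /= expg2.
  by lia.
move: rel; rewrite tt1 mulg1 -expgzM => /xk; move: ij; rewrite j0.
by move=> ij /eqP; rewrite mulf_eq0 => /orP []; lia.
Qed.

Theorem theorem5p2 (G : groupType) :
  torsion_free G ->
  (algebraically_hyperbolic G <->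
   adian_free G /\ weakly_algebraically_hyperbolic G).
Proof.
move=> tfG; split=> [AH|[noAdian wAH]].
  by split; [exact: AH_adian_free | exact: AH_weaklyAH].
split=> //; first exact: weaklyAH_CT.
move=> [K [H [T [sd ntH lcH TZ]]]].
exact: weaklyAH_no_semidirect sd ntH lcH TZ.
Qed.
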